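(* Let $m\ge 1$ be an integer, and for $n\ge 1$ let $M(m,n)$ denote the number of (not necessarily perfect) matchings of the $m$ by $n$ rectangular grid graph. Then there is a unique way of extending $M(m,n)$ to integers $n\le 0$, with rational values, so that the resulting bi-infinite sequence $(M(m,n))_{n\in\mathbb{Z}}$ satisfies a linear recurrence relation with constant coefficients. Moreover, in this extension $M(m,n)$ is an integer for every $n\in\mathbb{Z}$.
   Context: The $m$ by $n$ rectangular grid graph is the box (Cartesian) product $P_m\times P_n$ of the path graphs on $m$ and $n$ vertices. A matching of a graph is a set of edges no two of which share a vertex (the empty set is allowed; vertices not incident with a chosen edge are regarded as monomers). A bi-infinite sequence $(a_n)_{n\in\mathbb{Z}}$ satisfies a linear recurrence relation (of finite degree) with constant coefficients if there are $k\ge 1$ and constants $c_1,\dots,c_k$ with $c_k\ne 0$ such that $a_n=c_1a_{n-1}+c_2a_{n-2}+\cdots+c_ka_{n-k}$ for all $n\in\mathbb{Z}$. *)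

(* Defs.v *)
From mathcomp Require Import all_boot all_order all_algebra.
Set Implicit Arguments.
Unset Strict Implicit.
Unset Printing Implicit Defensive.
Import GRing.Theory Num.Theory.
Local Open Scope ring_scope.

(* A simple graph is given by its (symmetric, irreflexive) adjacency relation
   on a finite type of vertices. *)

Definition path_graph (n : nat) : rel 'I_n :=
  fun i j => (i.+1 == j :> nat) || (j.+1 == i :> nat).

Definition box_product (T1 T2 : finType) (e1 : rel T1) (e2 : rel T2)
    : rel (T1 * T2) :=
  fun x y => ((x.1 == y.1) && e2 x.2 y.2) || (e1 x.1 y.1 && (x.2 == y.2)).

Definition grid_graph (m n : nat) : rel ('I_m * 'I_n) :=
  box_product (@path_graph m) (@path_graph n).

(* Edges are unordered pairs of adjacent vertices, as elements of {set T}. *)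
Definition edges (T : finType) (e : rel T) : {set {set T}} :=
  [set E : {set T} | [exists x, exists y, e x y && (E == [set x; y])]].

Definition is_matching (T : finType) (e : rel T) (M : {set {set T}}) : bool :=
  (M \subset edges e) && trivIset M.

Definition num_matchings (m n : nat) : nat :=
  #|[set M | is_matching (@grid_graph m n) M]|.

(* The coefficients c_1, ..., c_k are the values c 1, ..., c k of a function on
   nat; its other values are irrelevant. *)
Definition linear_recurrent (F : fieldType) (a : int -> F) : Prop :=
  exists (k : nat) (c : nat -> F),
    [/\ (0 < k)%N, c k != 0 &
        forall n : int, a n = \sum_(1 <= i < k.+1) c i * a (n - i%:Z)].

Definition recurrent_extension (m : nat) (a : int -> rat) : Prop :=
  (forall n : nat, (0 < n)%N -> a n%:Z = (num_matchings m n)%:R) /\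
  linear_recurrent a.

(* Main.v *)
Require Import Defs.
From mathcomp Require Import all_boot all_order all_algebra all_fingroup zify.
Set Implicit Arguments.
Unset Strict Implicit.
Unset Printing Implicit Defensive.
Import GRing.Theory Num.Theory.

(** The proof is by the transfer matrix method, and the point is that the transfer
    matrix is invertible over the integers.

    Cut the grid into [n] layers, each a path on [m] vertices.  A matching of the
    grid is built layer by layer; all that matters about the part already built
    is the set [S] of top vertices that are joined to the next layer.  If a layer
    is joined to the next one over [S] and to the previous one over [R], then [S]
    and [R] are disjoint and the rest of the layer carries an arbitrary matching
    of the path induced on the complement of their union.  Let [A] be the matrix,
    indexed by sets of vertices of a layer, whose [(S, R)] entry is the number of
    these matchings, or [0] if [S] meets [R].  Then [M(m, n)] is the entry
    [(set0, set0)] of [A ^+ n] ([stack_step], [prism_transfer_power]).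

    A permutation of the sets contributes to the determinant of [A] only if it
    sends every set to a disjoint one; comparing total cardinalities, it must be
    the complement ([disjoint_perm_setC]), and its entries count the matchings
    of the empty graph, so they are [1].  Hence the determinant of [A] is [1] or
    [-1], and [A ^ n] is an integer matrix for every integer [n].  Its
    [(set0, set0)] entry is the required extension: it is an integer, and the
    Cayley-Hamilton theorem gives a recurrence whose last coefficient is the
    determinant up to sign ([unimodular_recurrent]).

    Uniqueness holds for recurrent sequences in general: two of them that agree
    from some point on are equal, because a recurrence whose last coefficient is
    not zero can be run backwards ([linear_recurrent_unique]).

    The layers may be copies of any finite graph, and the counting is carried out
    in that generality. *)

(** * Matchings inside a set of vertices *)

Definition matchings_in (T : finType) (e : rel T) (A : {set T}) :=
  [set M | is_matching e M & M \subset powerset A].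

Definition matching_count (T : finType) (e : rel T) (A : {set T}) : nat :=
  #|matchings_in e A|.

Lemma edgesP (T : finType) (e : rel T) (E : {set T}) :
  reflect (exists x y, e x y /\ E = [set x; y]) (E \in edges e).
Proof.
rewrite inE; apply: (iffP existsP) => [[x /existsP[y /andP[exy /eqP->]]]|].
  by exists x, y.
by move=> [x [y [exy ->]]]; exists x; apply/existsP; exists y; rewrite exy /=.
Qed.

Lemma matchings_inP (T : finType) (e : rel T) (A : {set T}) M :
  reflect [/\ trivIset M, forall E, E \in M -> E \in edges e
            & forall E, E \in M -> E \subset A]
          (M \in matchings_in e A).
Proof.
rewrite inE; apply: (iffP andP).
  move=> [/andP[/subsetP Me Mt] /subsetP MA]; split=> // E /MA.
  by rewrite powersetE.
move=> [Mt Me MA]; split; first by rewrite /is_matching Mt andbT; apply/subsetP.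
by apply/subsetP => E /MA; rewrite powersetE.
Qed.

Lemma cover_matching_sub (T : finType) (e : rel T) (A : {set T}) M :
  M \in matchings_in e A -> cover M \subset A.
Proof. by case/matchings_inP => _ _ MA; apply/bigcupsP. Qed.

(** This is why the entries that survive in the determinant of the transfer matrix
    are units. *)
Lemma matching_count0 (T : finType) (e : rel T) : matching_count e set0 = 1.
Proof.
rewrite /matching_count -(cards1 (set0 : {set {set T}})); apply: eq_card => M.
rewrite inE; apply/matchings_inP/eqP => [[_ Me MA]|->].
  apply/eqP; apply: contraT => /set0Pn[E EM].
  have := MA _ EM; rewrite subset0 => /eqP E0.
  have /edgesP[x [y [_ /setP/(_ x)]]] := Me _ EM.
  by rewrite E0 !inE eqxx.
by split=> [|E|E]; rewrite ?inE //; apply/trivIsetP => E F; rewrite inE.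
Qed.

(** Matchings live on sets of sets of vertices, so the matchings of two layers of
    the grid are different objects; this transports them along the inclusion of
    a layer and makes the transfer matrix independent of the layer. *)
Lemma matching_count_embed (T T' : finType) (e : rel T) (e' : rel T')
    (f : T -> T') (U : {set T}) :
  injective f -> (forall x y, e' (f x) (f y) = e x y) ->
  matching_count e' (f @: U) = matching_count e U.
Proof.
move=> f_inj e'f; rewrite /matching_count.
rewrite -(card_imset (matchings_in e U) (imset_inj (imset_inj f_inj))).
apply: eq_card => M'; apply/idP/imsetP => [/matchings_inP[M't M'e M'U]|].
  pose M := [set E : {set T} | f @: E \in M'].
  have M'E : M' = [set f @: (E : {set T}) | E in M].
    apply/setP => F; apply/idP/imsetP => [FM'|[E]]; last by rewrite inE => ? ->.
    have FE : F = f @: (f @^-1: F).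
      apply/setP => y; apply/idP/imsetP => [yF|[x]]; last by rewrite inE => ? ->.
      have /imsetP[x _ yE] := subsetP (M'U _ FM') _ yF.
      by exists x; rewrite // inE -yE.
    by exists (f @^-1: F); rewrite // inE -FE.
  exists M => //; apply/matchings_inP; split=> [|E|E].
  - by rewrite -(imset_trivIset _ f_inj) -M'E.
  - rewrite inE => EM'; have /edgesP[a [b [e'ab Eab]]] := M'e _ EM'.
    have /imsetP[x xE aE] : a \in f @: E by rewrite Eab !inE eqxx.
    have /imsetP[y yE bE] : b \in f @: E by rewrite Eab !inE eqxx orbT.
    apply/edgesP; exists x, y; rewrite -e'f -aE -bE; split=> //.
    by apply: (imset_inj f_inj); rewrite Eab imsetU1 imset_set1 aE bE.
  - rewrite inE => EM'; apply/subsetP => x xE.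
    have := subsetP (M'U _ EM') (f x) (imset_f f xE).
    by rewrite mem_imset.
move=> [M /matchings_inP[Mt Me MU] ->]; apply/matchings_inP; split.
- by rewrite imset_trivIset.
- move=> _ /imsetP[E /Me /edgesP[x [y [exy ->]]] ->].
  apply/edgesP; exists (f x), (f y); rewrite e'f; split=> //=.
  by rewrite imsetU1 imset_set1.
- by move=> _ /imsetP[E /MU EU ->]; apply: imsetS.
Qed.

(** Once the set [D] of edges that cross between [X] and [Y] is prescribed, the
    rest of the matching is an arbitrary pair of matchings, one on each side,
    that avoid the vertices already used by [D].  The bijection glues such a
    pair to [D]; it is undone by intersecting with the powersets of the sides,
    because an edge is nonempty and so cannot lie in both. *)
Lemma card_matchings_crossing (T : finType) (e : rel T) (X Y A : {set T})
    (D : {set {set T}}) :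
  [disjoint X & Y] -> D \in matchings_in e A ->
  (forall E, E \in D -> E \notin powerset X :|: powerset Y) ->
  #|[set M in matchings_in e A | M :\: (powerset X :|: powerset Y) == D]| =
  matching_count e (A :&: X :\: cover D) * matching_count e (A :&: Y :\: cover D).
Proof.
move=> XY DA Dcross; have /matchings_inP[Dt De DsA] := DA.
rewrite /matching_count -cardsX.
(* An edge has a vertex, and the sides are disjoint. *)
have no_both E : E \in edges e -> E \subset X -> E \subset Y -> False.
  move=> /edgesP[x [y [_ ->]]] /subsetP sX /subsetP sY.
  by have := sY x (set21 x y); rewrite (disjointFr XY (sX x (set21 x y))).
pose glue (p : {set {set T}} * {set {set T}}) := p.1 :|: p.2 :|: D.
have sub_side (Z : {set T}) M : M \in matchings_in e (A :&: Z :\: cover D) ->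
    M \subset powerset Z.
  case/matchings_inP => _ _ MZ; apply/subsetP => E /MZ; rewrite powersetE.
  by move/subset_trans; apply; apply/subsetP => x; rewrite !inE => /and3P[].
have glueK p : p \in setX (matchings_in e (A :&: X :\: cover D))
                          (matchings_in e (A :&: Y :\: cover D)) ->
    [/\ glue p :&: powerset X = p.1, glue p :&: powerset Y = p.2
      & glue p :\: (powerset X :|: powerset Y) = D].
  rewrite inE => /andP[M1 M2].
  have [/matchings_inP[_ e1 _] sX] := (M1, sub_side _ _ M1).
  have [/matchings_inP[_ e2 _] sY] := (M2, sub_side _ _ M2).
  have Y1 : p.1 :&: powerset Y = set0.
    apply/setP => E; rewrite !inE; apply/negP => /andP[E1].
    by apply: no_both (e1 _ E1) _; rewrite -powersetE (subsetP sX).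
  have X2 : p.2 :&: powerset X = set0.
    apply/setP => E; rewrite !inE; apply/negP => /andP[E2 /no_both].
    by apply; [exact: e2 | rewrite -powersetE (subsetP sY)].
  have D0 : D :&: (powerset X :|: powerset Y) = set0.
    by apply/setP => E; rewrite inE in_set0; apply/negP => /andP[/Dcross/negP].
  have [DX DY] : D :&: powerset X = set0 /\ D :&: powerset Y = set0.
    by move: D0; rewrite setIUr => /eqP; rewrite setU_eq0 => /andP[/eqP-> /eqP->].
  have D12 : (p.1 :|: p.2) :\: (powerset X :|: powerset Y) = set0.
    by apply/eqP; rewrite setD_eq0; apply: setUSS.
  split; rewrite /glue.
  - by rewrite !setIUl X2 DX !setU0; apply/setIidPl.
  - by rewrite !setIUl Y1 DY set0U setU0; apply/setIidPl.
  - by rewrite setDUl D12 set0U; apply/setDidPl; rewrite -setI_eq0 D0.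
have glue_inj : {in setX (matchings_in e (A :&: X :\: cover D))
                         (matchings_in e (A :&: Y :\: cover D)) &, injective glue}.
  move=> [M1 M2] [N1 N2] /glueK[/= EX EY _] /glueK[/= EX' EY' _] E.
  by congr (_, _); [rewrite -EX -EX' E | rewrite -EY -EY' E].
rewrite -(card_in_imset glue_inj); apply: eq_card => M.
apply/idP/imsetP => [|[p p_in ->]]; last first.
  have [_ _ pD] := glueK p p_in.
  rewrite inE pD eqxx andbT; move: p_in; rewrite inE => /andP[M1 M2].
  have [c1 c2] := (cover_matching_sub M1, cover_matching_sub M2).
  have /matchings_inP[t1 e1 s1] := M1; have /matchings_inP[t2 e2 s2] := M2.
  have cU : cover (p.1 :|: p.2) = cover p.1 :|: cover p.2 by rewrite /cover bigcup_setU.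
  apply/matchings_inP; split.
  - apply: trivIsetU => //.
      apply: trivIsetU => //; apply: disjointW c1 c2 _.
      rewrite -setI_eq0; apply/eqP/setP => x; rewrite !inE.
      by have := disjointFr XY (x := x); case: (x \in X) => [->|]; rewrite ?andbF.
    rewrite cU -setI_eq0; apply/eqP/setP => x; rewrite !inE.
    apply/negP => /andP[/orP[/(subsetP c1)|/(subsetP c2)]];
      by rewrite inE => /andP[/negPf->].
  - by move=> E /setUP[/setUP[/e1|/e2]|/De].
  - move=> E /setUP[/setUP[/s1|/s2]|/DsA//] /subset_trans; apply.
      by apply/subsetP => x; rewrite !inE => /and3P[].
    by apply/subsetP => x; rewrite !inE => /and3P[].
rewrite inE => /andP[/matchings_inP[Mt Me MA] /eqP MD].
have side Z : Z \in [:: X; Y] ->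
    M :&: powerset Z \in matchings_in e (A :&: Z :\: cover D).
  move=> Z_in; apply/matchings_inP; split=> [|E|E].
  - by apply: trivIsetS Mt; apply: subsetIl.
  - by move=> /setIP[/Me].
  move=> /setIP[EM]; rewrite powersetE => EZ.
  apply/subsetP => x xE; rewrite !inE (subsetP (MA _ EM)) // (subsetP EZ) // !andbT.
  apply/bigcupP => -[F FD xF].
  have FM : F \in M by move: FD; rewrite -MD => /setDP[].
  have EF : E != F.
    apply: contraTneq (Dcross _ FD) => <-; rewrite negbK !inE.
    by move: Z_in; rewrite !inE => /orP[]/eqP<-; rewrite EZ ?orbT.
  by have := disjointFr (trivIsetP Mt _ _ EM FM EF) xE; rewrite xF.
exists (M :&: powerset X, M :&: powerset Y).
  by rewrite inE /= !side ?inE ?eqxx ?orbT.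
by rewrite /glue /= -setIUr -MD setID.
Qed.

(** * Layers of the product of a graph with a path *)

Local Notation prism e n := (box_product e (@path_graph n)).

(** The layers below [j] in full, and those vertices of layer [j] that are not
    in [S]: [S] holds the vertices that edges going up to layer [j.+1] use. *)
Definition stack {T : finType} {n : nat} (j : nat) (S : {set T}) : {set T * 'I_n} :=
  [set x : T * 'I_n | (x.2 < j) || ((x.2 == j :> nat) && (x.1 \notin S))].

Definition layer (T : finType) (n : nat) (j : 'I_n) (U : {set T}) : {set T * 'I_n} :=
  [set (i, j) | i in U].

Lemma matching_count_layer (T : finType) (e : rel T) n (j : 'I_n) U :
  matching_count (prism e n) (layer j U) = matching_count e U.
Proof.
apply: matching_count_embed => [x y [] //|x y].
by rewrite /box_product /path_graph /= eqxx andbT (gtn_eqF (leqnn _)) andbF.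
Qed.

(** The number of ways to complete a layer by edges inside it, when the vertices in
    [S] are joined to the next layer and those in [R] to the previous one. *)
Definition transfer (T : finType) (e : rel T) (S R : {set T}) : nat :=
  if [disjoint S & R] then matching_count e (~: (S :|: R)) else 0.

(** Classify the matchings by the set [R] of vertices of layer [j] that are joined
    to layer [j'].  The edges over [R] are exactly the crossing edges, so each
    class splits as a matching of the lower layers and one of layer [j']. *)
Lemma stack_step (T : finType) (e : rel T) n (j j' : 'I_n) S : j' = j.+1 :> nat ->
  matching_count (prism e n) (stack j' S)
    = \sum_R transfer e S R * matching_count (prism e n) (stack j R).
Proof.
move=> jj'.
pose rung i : {set T * 'I_n} := [set (i, j); (i, j')].
have j'j : (j == j') = false by apply/eqP => E; rewrite -E in jj'; lia.
have rung_inj : injective rung.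
  move=> i1 i2 /setP/(_ (i1, j)).
  by rewrite !inE !xpair_eqE !eqxx j'j !andbF !orbF ?andbT => E; apply/eqP; rewrite -E.
pose X := [set x : T * 'I_n | (x.2 <= j)].
pose Y := [set x : T * 'I_n | x.2 == j' :> nat].
pose cross (M : {set {set T * 'I_n}}) := M :\: (powerset X :|: powerset Y).
have XY : [disjoint X & Y].
  rewrite -setI_eq0; apply/eqP/setP => x; rewrite !inE.
  by apply/negP => /andP[le_x /eqP x2]; rewrite x2 in le_x; lia.
have rung_cross i : rung i \notin powerset X :|: powerset Y.
  rewrite !inE negb_or; apply/andP; split; apply/subsetPn.
    by exists (i, j'); rewrite !inE ?eqxx ?orbT //= -ltnNge jj'.
  by exists (i, j); rewrite !inE ?eqxx //= jj' neq_ltn ltnSn.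
pose rungs (M : {set {set T * 'I_n}}) := [set i | rung i \in M].
(* Every edge that lies neither below [j'] nor inside layer [j'] is a rung. *)
have crossE M : M \in matchings_in (prism e n) (stack j' S) -> cross M = rung @: rungs M.
  case/matchings_inP => _ Me MS; apply/setP => E; apply/setDP/imsetP; last first.
    by move=> [i]; rewrite inE => iM ->.
  move=> [EM]; have /edgesP[[a b] [[c d] [adj ED]]] := Me _ EM.
  have := MS _ EM; rewrite {1 2}ED subUset !sub1set !inE !subUset !sub1set !inE /=.
  move=> /andP[b_le d_le] /norP[bdX bdY].
  have {b_le d_le bdX bdY} bd : (b == j) && (d == j') || (b == j') && (d == j).
    case/orP: adj => /= /andP[_]; first by rewrite -!val_eqE /path_graph /=; lia.
    move/eqP => bd; rewrite bd -!val_eqE /= in b_le d_le bdX bdY *.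
    lia.
  have ac : a = c.
    case/orP: adj => /= /andP[/eqP//] _ /eqP bd'; move: bd.
    by rewrite bd' => /orP[]/andP[/eqP->]; rewrite ?j'j // eq_sym j'j.
  have ER : E = rung a.
    by rewrite ED -ac; case/orP: bd => /andP[/eqP-> /eqP->] //; rewrite setUC.
  by exists a; rewrite // inE -ER.
rewrite {1}/matching_count -sum1_card (partition_big rungs predT) //=.
apply: eq_bigr => R _; rewrite sum1dep_card.
have cover_rungs x : (x \in cover (rung @: R)) =
    (x.1 \in R) && ((x.2 == j) || (x.2 == j')).
  rewrite /cover; apply/bigcupP/andP => [[_ /imsetP[i iR ->]]|[xR x2]].
    by rewrite !inE => /orP[]/eqP-> /=; rewrite iR eqxx ?orbT.
  exists (rung x.1); first exact: imset_f.
  by case: x x2 {xR} => i l /= /orP[]/eqP->; rewrite !inE eqxx ?orbT.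
rewrite /transfer; case: ifPn => SR; last first.
  (* A vertex of [S] is absent from the stack, so no rung can end there. *)
  rewrite mul0n; apply/eqP; rewrite cards_eq0; apply/eqP/setP => M.
  rewrite in_set0 inE; apply/negP => /andP[/matchings_inP[_ _ MS] /eqP MR].
  case/pred0Pn: SR => i /= /andP[iS]; rewrite -MR inE => /MS /subsetP.
  by move=> /(_ (i, j')); rewrite !inE !eqxx orbT /= iS ltnn => /(_ isT).
have SR' i : i \in R -> i \notin S.
  by move=> iR; rewrite (disjointFl SR).
have lower : stack j' S :&: X :\: cover (rung @: R) = stack j R.
  apply/setP => x; rewrite inE cover_rungs !inE -!val_eqE /=.
  by case: (x.1 \in R); lia.
have upper : stack j' S :&: Y :\: cover (rung @: R) = layer j' (~: (S :|: R)).
  apply/setP => -[i l]; rewrite inE cover_rungs !inE -!val_eqE /=.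
  apply/idP/imsetP => [H|[i']].
    exists i; first by rewrite !inE; lia.
    by congr (_, _); apply: val_inj => /=; lia.
  by rewrite !inE => /norP[iS iR] [-> ->]; rewrite (negPf iR) (negPf iS); lia.
have R_matching : rung @: R \in matchings_in (prism e n) (stack j' S).
  apply/matchings_inP; split.
  - apply/trivIsetP => _ _ /imsetP[i1 _ ->] /imsetP[i2 _ ->] i12.
    rewrite -setI_eq0; apply/eqP/setP => -[i l]; rewrite !inE !xpair_eqE.
    apply: contraNF i12 => /andP[/orP[]/andP[/eqP-> _] /orP[]/andP[/eqP-> _]];
      exact: eqxx.
  - move=> _ /imsetP[i _ ->]; apply/edgesP; exists (i, j), (i, j').
    by rewrite /box_product /path_graph /= eqxx jj' eqxx.
  - move=> _ /imsetP[i iR ->]; rewrite subUset !sub1set !inE /= jj' ltnS leqnn.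
    by rewrite ltnn eqxx SR'.
have R_cross E : E \in rung @: R -> E \notin powerset X :|: powerset Y.
  by case/imsetP => i _ ->.
rewrite mulnC -(matching_count_layer e j') -lower -upper.
rewrite -(card_matchings_crossing XY R_matching R_cross).
apply: eq_card => M; rewrite [LHS]inE [RHS]inE /=.
have [MS|//] := boolP (M \in matchings_in (prism e n) (stack j' S)).
by rewrite -/(cross M) crossE // (inj_eq (imset_inj rung_inj)).
Qed.

(** The bottom layer behaves as if an empty set of edges came from below it, so
    the recursion may be started at the unit vector of [set0]. *)
Lemma stack_bottom (T : finType) (e : rel T) n (j : 'I_n) S : j = 0%N :> nat ->
  matching_count (prism e n) (stack j S) = transfer e S set0.
Proof.
move=> j0; rewrite /transfer -setI_eq0 setI0 eqxx setU0 -(matching_count_layer e j).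
congr (matching_count (prism e n) _); apply/setP => -[i l]; rewrite !inE j0 /=.
apply/andP/imsetP => [[/eqP l0 iS]|[i' iS [-> ->]]].
  by exists i; rewrite ?inE //; congr (_, _); apply: val_inj; rewrite /= l0.
by rewrite j0 eqxx; split=> //; move: iS; rewrite inE.
Qed.

Lemma stack_top (T : finType) (j : nat) : @stack T j.+1 j set0 = setT.
Proof.
by apply/setP => x; rewrite !inE andbT; case: x => i [l lt_l] /=; lia.
Qed.

Lemma transfer_compl (T : finType) (e : rel T) (S : {set T}) :
  transfer e S (~: S) = 1.
Proof.
by rewrite /transfer -setI_eq0 setICr eqxx setUCr setCT matching_count0.
Qed.

(** * Bi-infinite linear recurrences *)

Local Open Scope ring_scope.

Definition satisfies_recurrence (F : fieldType) (k : nat) (c : nat -> F) (a : int -> F) :=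
  forall n : int, a n = \sum_(1 <= i < k.+1) c i * a (n - i%:Z).

(** As [c k] is invertible, the recurrence can be run backwards: it expresses
    [a n] through [a (n + 1)], ..., [a (n + k)]. *)
Lemma recurrence_eventually0 (F : fieldType) k (c : nat -> F) (a : int -> F) n0 :
  (0 < k)%N -> c k != 0 -> satisfies_recurrence k c a ->
  (forall n, n0 <= n -> a n = 0) -> forall n, a n = 0.
Proof.
move=> k_gt0 ck a_rec a0.
have back (t : nat) : forall n, n0 - t%:Z <= n -> a n = 0.
  elim: t => [|t IH] n le_n; first by apply: a0; lia.
  have [{}le_n|lt_n] := lerP (n0 - t%:Z) n; first exact: IH.
  have := a_rec (n + k%:Z); rewrite IH; last by lia.
  rewrite big_nat_recr //= big_nat big1 ?add0r => [|i /andP[_ lt_i]]; last first.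
    by rewrite IH ?mulr0 //; lia.
  by move/esym/eqP; rewrite mulf_eq0 (negPf ck) addrK => /eqP.
by move=> n; apply: (back `|n0 - n|%N); lia.
Qed.

(** The two sequences may come with different recurrences.  The defect [b - u] of
    [b] in the recurrence of [a] vanishes from some point on and, by linearity
    and shift invariance, satisfies the recurrence of [b]; hence it vanishes
    everywhere.  So [b] satisfies the recurrence of [a], and so does [b - a]. *)
Lemma linear_recurrent_unique (F : fieldType) (a b : int -> F) n0 :
  linear_recurrent a -> linear_recurrent b ->
  (forall n, n0 <= n -> b n = a n) -> b =1 a.
Proof.
move=> [k [c [k_gt0 ck a_rec]]] [l [e [l_gt0 el b_rec]]] ab.
have sub_rec p f (x y : int -> F) : satisfies_recurrence p f x ->
    satisfies_recurrence p f y ->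
    satisfies_recurrence p f (fun n => x n - y n).
  move=> xr yr n; rewrite xr yr -sumrB.
  by apply: eq_bigr => i _; rewrite mulrBr.
pose u n := \sum_(1 <= i < k.+1) c i * b (n - i%:Z).
have u_rec : satisfies_recurrence l e u.
  move=> n; under [RHS]eq_bigr do rewrite mulr_sumr.
  rewrite exchange_big; apply: eq_bigr => i _ /=.
  rewrite b_rec mulr_sumr; apply: eq_bigr => j _.
  by rewrite mulrCA addrAC.
have b_rec' : satisfies_recurrence k c b.
  move=> n; apply/eqP; rewrite -subr_eq0; apply/eqP; move: n.
  apply: (recurrence_eventually0 (n0 := n0 + k%:Z) l_gt0 el (sub_rec _ _ _ _ b_rec u_rec)).
  move=> n le_n; apply/eqP; rewrite subr_eq0 ab; last by lia.
  rewrite a_rec; apply/eqP; rewrite /u !big_nat; apply: eq_bigr => i lt_i.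
  by rewrite ab //; lia.
move=> n; apply/eqP; rewrite -subr_eq0; apply/eqP; move: n.
apply: (recurrence_eventually0 (n0 := n0) k_gt0 ck (sub_rec _ _ _ _ b_rec' a_rec)).
by move=> n le_n; rewrite ab // subrr.
Qed.

(** * Powers of a unimodular matrix *)

(** Multiply the Cayley-Hamilton relation by a possibly negative power of [A].
    The last coefficient of the recurrence is the determinant of [A] up to sign,
    which is not zero.  Working over [int] makes the entries of the negative
    powers integers for free. *)
Lemma unimodular_recurrent d (A : 'M[int]_d.+1) (v : 'cV[int]_d.+1) i :
  A \in unitmx ->
  linear_recurrent (fun n : int => ((A ^ n *m v) i 0)%:~R : rat).
Proof.
move=> A_unit; pose p := char_poly A.
exists d.+1, (fun j => - (p`_(d.+1 - j))%:~R); split=> //.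
  rewrite subnn oppr_eq0 intr_eq0 char_poly_det mulf_neq0 ?signr_eq0 //.
  by apply: contraTneq A_unit => detA0; rewrite unitmxE detA0 unitr0.
move=> n.
have CH : \sum_(j < d.+2) p`_j *: A ^+ j = 0.
  rewrite -[RHS](Cayley_Hamilton A) /horner_mx /horner_morph.
  rewrite horner_coef size_map_poly_id0; last first.
    by rewrite (monicP (char_poly_monic A)) rmorph1 oner_neq0.
  rewrite size_char_poly; apply: eq_bigr => j _.
  by rewrite coef_map /= -mul_scalar_mx.
have {}CH : A ^ n = - \sum_(1 <= j < d.+2) p`_(d.+1 - j) *: A ^ (n - j%:Z).
  apply/eqP; rewrite -addr_eq0; apply/eqP.
  have := congr1 (fun B => B * A ^ (n - d.+1%:Z)) CH.
  rewrite mul0r mulr_suml => {CH} CH; rewrite -[RHS]CH.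
  (* The recurrence lists the powers downwards, the polynomial upwards; the first
     term after reversal is the leading, monic one. *)
  rewrite [RHS](reindex_inj rev_ord_inj) /= big_ord_recl /= subn1 /=.
  have -> : p`_d.+1 = 1.
    by move/monicP: (char_poly_monic A); rewrite lead_coefE size_char_poly.
  rewrite scale1r [A ^+ _]exprnP -exprzDr // subrKC; congr (_ + _).
  rewrite big_add1 big_mkord; apply: eq_bigr => j _.
  rewrite /= -scalerAl [A ^+ _]exprnP -exprzDr // subSS.
  by congr (_ *: A ^ _); case: j => j lt_j; rewrite /= /bump /=; lia.
rewrite CH mulNmx mulmx_suml !mxE summxE rmorphN rmorph_sum -sumrN.
by apply: eq_bigr => j _; rewrite -scalemxAl !mxE rmorphM mulNr.
Qed.

(** Only one term of the Leibniz expansion survives, so the determinant is a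
    sign. *)
Lemma det_unique_perm d (A : 'M[int]_d) (s : 'S_d) :
  (forall t : 'S_d, (forall i, A i (t i) != 0) -> t = s) ->
  (forall i, A i (s i) = 1) -> A \in unitmx.
Proof.
move=> s_only As; rewrite unitmxE /determinant (bigD1 s) //= [X in _ + X]big1.
  rewrite addr0 big1 // mulr1; exact: unitrX (unitrN1 _).
move=> t /eqP ts; case: (pickP (fun i => A i (t i) == 0)) => [i /eqP Ai0|nz].
  by rewrite (bigD1 i) //= Ai0 mul0r mulr0.
by case: ts; apply: s_only => i; rewrite nz.
Qed.

(** * The transfer matrix *)

(** Disjointness gives [#|t S| <= #|~: S|] for each [S]; summed over all [S] both
    sides are equal, since [t] and the complement permute the sets, so every
    inequality is an equality. *)
Lemma disjoint_perm_setC (T : finType) (t : {set T} -> {set T}) :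
  injective t -> (forall S : {set T}, [disjoint S & t S]) -> forall S, t S = ~: S.
Proof.
move=> t_inj t_disj.
have leq_t (S : {set T}) : true -> (#|t S| <= #|~: S| ?= iff (t S == ~: S))%N.
  by move=> _; apply: subset_leqif_cards; rewrite -disjoints_subset disjoint_sym.
have same_sum : (\sum_S #|t S| = \sum_(S : {set T}) #|~: S|)%N.
  transitivity (\sum_(S : {set T}) #|S|)%N.
    by rewrite [RHS](reindex_inj t_inj).
  by rewrite [LHS](reindex_inj (@setC_inj T)).
have /eq_leqif := leqif_sum (P := predT) leq_t.
rewrite /= same_sum eqxx => /esym/forallP all_t S.
exact/eqP/all_t.
Qed.

(** The transfer matrix is unimodular: a permutation with a nonzero term in the
    Leibniz expansion sends each [S] to a set disjoint from [S], so it is the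
    complement, whose entries are all [1].  Matrices need ordinal indices, whence
    the bijection [g] with inverse [h]. *)
Lemma prism_transfer_power (T : finType) (e : rel T) :
  exists d (A : 'M[int]_d.+1) (v : 'cV[int]_d.+1) (i0 : 'I_d.+1),
    A \in unitmx /\
    forall n : nat, (0 < n)%N ->
      (matching_count (prism e n) setT)%:Z = (A ^ n%:Z *m v) i0 0.
Proof.
have [d dE] : exists d, #|{set T}| = d.+1.
  by exists #|{set T}|.-1; rewrite prednK //; apply/card_gt0P; exists set0.
pose g (i : 'I_d.+1) : {set T} := enum_val (cast_ord (esym dE) i).
pose h (S : {set T}) : 'I_d.+1 := cast_ord dE (enum_rank S).
have gK : cancel g h by move=> i; rewrite /h /g enum_valK cast_ordKV.
have hK : cancel h g by move=> S; rewrite /h /g cast_ordK enum_rankK.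
pose A : 'M[int]_d.+1 := \matrix_(i, j) (transfer e (g i) (g j))%:Z.
pose v : 'cV[int]_d.+1 := \col_j (g j == set0)%:R.
exists d, A, v, (h set0); split.
  have s_inj : injective (fun i => h (~: g i)).
    by move=> i j /(can_inj hK)/setC_inj/(can_inj gK).
  apply: (@det_unique_perm _ A (perm s_inj)) => [t tnz|i]; last first.
    by rewrite mxE permE hK transfer_compl.
  apply/permP => i; rewrite permE; apply: (can_inj gK); rewrite hK.
  (* View [t] as a permutation of the sets themselves. *)
  rewrite -{1}(gK i); move: (g i); apply: disjoint_perm_setC => [|S].
    by move=> S R /(can_inj gK)/perm_inj/(can_inj hK).
  have := tnz (h S); rewrite mxE hK /transfer.
  by case: ifP.
have stack_power n (j : 'I_n) S :
    (matching_count (prism e n) (stack j S))%:Z = (A ^+ j.+1 *m v) (h S) 0.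
  case: j => j; elim: j S => [|j IH] S lt_j.
    rewrite stack_bottom // expr1 mxE (bigD1 (h set0)) //= big1 => [|k k0].
      by rewrite !mxE !hK eqxx mulr1 addr0.
    by rewrite !mxE -(inj_eq (can_inj hK)) gK (negPf k0) mulr0.
  have lt_j' := ltnW lt_j.
  rewrite (@stack_step _ _ _ (Ordinal lt_j') (Ordinal lt_j)) //.
  rewrite exprS -mulmxA mxE (reindex h) /=; last first.
    by exists g => ? _; [exact: hK | exact: gK].
  rewrite -natz natr_sum; apply: eq_bigr => R _.
  by rewrite natrM !natz IH [A (h S) (h R)]mxE !hK.
case=> // n _; rewrite -(stack_top T n).
exact: (stack_power n.+1 ord_max).
Qed.

Theorem mainTheorem1 (m : nat) (hm : (1 <= m)%N) :
  exists a : int -> rat,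
    [/\ recurrent_extension m a,
        forall b : int -> rat, recurrent_extension m b -> b =1 a &
        forall n : int, a n \is a Num.int].
Proof.
have [d [A [v [i0 [A_unit countE]]]]] := prism_transfer_power (@path_graph m).
have num_matchingsE n : num_matchings m n =
    matching_count (prism (@path_graph m) n) setT.
  apply: eq_card => M; rewrite !inE; case: is_matching => //=.
  by apply/esym/subsetP => E _; rewrite powersetE subsetT.
pose a (n : int) : rat := ((A ^ n *m v) i0 0)%:~R.
have a_rec : linear_recurrent a := unimodular_recurrent v i0 A_unit.
have aE (n : nat) : (0 < n)%N -> a n%:Z = (num_matchings m n)%:R.
  by move=> n_gt0; rewrite /a -countE // num_matchingsE.
exists a; split=> // [b [bE b_rec]|n]; last exact: intr_int.
apply: (linear_recurrent_unique (n0 := 1) a_rec b_rec) => -[n|n] // n_gt0.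
by rewrite bE // aE.
Qed.
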